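(* Let $n\geq 2$. Then $$|s^{-1}(\mathrm{Av}_n(132,231,312,321))|=2C_n-2C_{n-1}.$$ For every integer $m\ge 0$, the number of elements of $s^{-1}(\mathrm{Av}_n(132,231,312,321))$ with exactly $m$ descents is $$N(n,m+1)+\sum_{i=1}^{n-2}\sum_{j=1}^mN(n-i-1,j)\,N(i,m-j+1),$$ and the number of elements of $s^{-1}(\mathrm{Av}_n(132,231,312,321))$ with exactly $m$ peaks is $$V(n,m+1)+\sum_{i=1}^{n-2}\sum_{j=1}^mV(n-i-1,j)\,V(i,m-j+1).$$
   Context: $S_n$ is the set of permutations of $\{1,\ldots,n\}$, written as words. The stack-sorting map $s$ is defined recursively on words of distinct positive integers: $s$ sends the empty word to itself, and if $\pi=LNR$ where $N$ is the largest entry of $\pi$, then $s(\pi)=s(L)s(R)N$. Thus $s$ maps $S_n$ to $S_n$, and $s^{-1}(A)=\{\sigma\in S_n: s(\sigma)\in A\}$ for $A\subseteq S_n$. $\mathrm{Av}_n(\tau^{(1)},\ldots,\tau^{(r)})$ is the set of permutations in $S_n$ avoiding (in the classical sense) all the patterns $\tau^{(1)},\ldots,\tau^{(r)}$. A descent of $\pi\in S_n$ is an index $i\in\{1,\ldots,n-1\}$ with $\pi_i>\pi_{i+1}$; a peak is an index $i\in\{2,\ldots,n-1\}$ with $\pi_{i-1}<\pi_i>\pi_{i+1}$. $C_j=\frac{1}{j+1}\binom{2j}{j}$ is the $j$-th Catalan number. For integers $i,j\ge1$, $N(i,j)=\frac1i\binom{i}{j}\binom{i}{j-1}$ and $V(i,j)=2^{i-2j+1}\binom{i-1}{2j-2}C_{j-1}$.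 Binomial coefficients $\binom ab$ are $0$ unless $0\le b\le a$. *)

(* Defs.v *)
From mathcomp Require Import all_boot all_order all_algebra finmap.

Set Implicit Arguments.
Unset Strict Implicit.
Unset Printing Implicit Defensive.

Import GRing.Theory.
Local Open Scope nat_scope.
Local Open Scope fset_scope.

(* Permutations are words, i.e. sequences of letters 1, ..., n.               *)
Definition Sn (n : nat) : {fset seq nat} :=
  [fset w in permutations (iota 1 n)].

(* The recursion s(L N R) = s(L) s(R) N is not structural, so it is driven by *)
(* a bound k on the length of the word; stack_sort_max gives the recursion    *)
(* equation without the bound.                                                *)
Fixpoint stack_sort_rec (k : nat) (w : seq nat) : seq nat :=
  if k is k'.+1 then
    if w is [::] then [::] else
    let N := \max_(x <- w) x in
    let i := index N w in
    stack_sort_rec k' (take i w) ++ stack_sort_rec k' (drop i.+1 w) ++ [:: N]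
  else [::].

Definition stack_sort (w : seq nat) : seq nat := stack_sort_rec (size w) w.

Definition stack_preim (n : nat) (A : {fset seq nat}) : {fset seq nat} :=
  [fset w in Sn n | stack_sort w \in A].

Definition order_iso (u v : seq nat) : bool :=
  (size u == size v) &&
  [forall i : 'I_(size u), forall j : 'I_(size u),
     (nth 0 u i < nth 0 u j) == (nth 0 v i < nth 0 v j)].

(* Boolean masks enumerate the subsequences of w; see containsP.              *)
Definition contains (tau w : seq nat) : bool :=
  [exists b : (size w).-tuple bool, order_iso (mask b w) tau].

Definition Av (n : nat) (taus : seq (seq nat)) : {fset seq nat} :=
  [fset w in Sn n | all (fun tau => ~~ contains tau w) taus].

(* Letters are numbered from 1; the value at i = 0 is irrelevant.             *)
Definition letter (w : seq nat) (i : nat) : nat := nth 0 w i.-1.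

Definition descents (w : seq nat) : seq nat :=
  [seq i <- index_iota 1 (size w) | letter w i > letter w i.+1].

Definition peaks (w : seq nat) : seq nat :=
  [seq i <- index_iota 2 (size w) |
     (letter w i.-1 < letter w i) && (letter w i > letter w i.+1)].

Definition catalan (j : nat) : rat :=
  (j.+1%:R^-1 * 'C(2 * j, j)%:R)%R.

(* The numbers N(i, j) and V(i, j), intended for i, j >= 1 only. They are     *)
(* rational by definition; the exponent of 2 in V(i, j) may be negative.      *)
Definition Nnum (i j : nat) : rat :=
  (i%:R^-1 * 'C(i, j)%:R * 'C(i, j.-1)%:R)%R.

Definition Vnum (i j : nat) : rat :=
  (2 ^ (i%:Z - 2 * j%:Z + 1) * 'C(i.-1, 2 * j - 2)%:R * catalan j.-1)%R.

Lemma mem_Sn (n : nat) (w : seq nat) : (w \in Sn n) = perm_eq w (iota 1 n).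
Proof. by rewrite inE /= mem_permutations. Qed.

Lemma containsP (tau w : seq nat) :
  reflect (exists2 u, subseq u w & order_iso u tau) (contains tau w).
Proof.
apply: (iffP existsP) => [[b iso_b]|[u /subseqP[b sz_b ->] iso_b]].
  by exists (mask b w) => //; apply: mask_subseq.
by exists (Tuple (introT eqP sz_b)).
Qed.

Lemma stack_sort_rec_bound (k : nat) (w : seq nat) :
  size w <= k -> stack_sort_rec k w = stack_sort w.
Proof.
rewrite /stack_sort.
have [l] := ubnP (maxn k (size w)); elim: l k w => // l IHl [|k] [|x w] //.
rewrite ltnS geq_max => /andP[lek lew] /= lewk.
set N := \max_(y <- x :: w) y; pose i := index N (x :: w).
have Ni : i < size (x :: w).
  rewrite /i index_mem /N; elim: (w) (x) => [|y s IHs] z.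
    by rewrite big_seq1 mem_head.
  rewrite big_cons /maxn; case: ifP => _; last exact: mem_head.
  by rewrite inE IHs orbT.
have sL : size (take i (x :: w)) <= size w by rewrite size_take Ni -ltnS.
have sR : size (drop i.+1 (x :: w)) <= size w by rewrite size_drop subSS leq_subr.
have fix_ s : size s <= size w ->
    stack_sort_rec k s = stack_sort_rec (size w) s.
  move=> les; have lesk := leq_trans les lewk.
  rewrite (IHl k s) ?(IHl (size w) s) // gtn_max ?lek ?lew /=.
    exact: leq_ltn_trans les lew.
  exact: leq_ltn_trans lesk lek.
by congr (_ ++ _); [exact: fix_ sL|congr (_ ++ _); exact: fix_ sR].
Qed.

Lemma stack_sort_nil : stack_sort [::] = [::].
Proof. by []. Qed.

Lemma stack_sort_max (L R : seq nat) (N : nat) :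
    all (ltn^~ N) (L ++ R) ->
  stack_sort (L ++ N :: R) = stack_sort L ++ stack_sort R ++ [:: N].
Proof.
rewrite all_cat => /andP[/allP ltL /allP ltR].
have maxN : \max_(x <- L ++ N :: R) x = N.
  apply/eqP; rewrite eqn_leq; apply/andP; split.
    apply/bigmax_leqP_seq => x; rewrite mem_cat inE.
    by case/or3P=> [/ltL/ltnW|/eqP->|/ltR/ltnW].
  by apply: (@leq_bigmax_seq _ _ xpredT id) => //; rewrite mem_cat mem_head orbT.
have NL : N \notin L by apply/negP => /ltL /=; rewrite ltnn.
have idx : index N (L ++ N :: R) = size L.
  by rewrite index_cat (negPf NL) /= eqxx addn0.
rewrite {1}/stack_sort size_cat /= addnS /=.
case E: (L ++ N :: R) => [|y s]; first by case: (L) E.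
rewrite -E maxN idx take_size_cat //.
have -> : drop (size L).+1 (L ++ N :: R) = R.
  by rewrite -cat_rcons drop_size_cat ?size_rcons.
by rewrite !stack_sort_rec_bound ?leq_addr ?leq_addl.
Qed.

(* Main.v *)
(* Avoiding 132, 231, 312 and 321 means that in every length-3 subsequence    *)
(* the last letter is the largest, which leaves only the words 1 2 3 ... n    *)
(* and 2 1 3 ... n. Splitting a preimage L N S of either word at its maximum  *)
(* shows that the generating functions M_n of the preimages of                *)
(* 1 2 ... (n+1), weighted by descents or by peaks, satisfy                   *)
(*   M_(n+1) = c M_n + t sum_(i < n) M_i M_(n-1-i),                           *)
(* with c collecting the splits where exactly one of L, S is empty (c = 1 + t *)
(* for descents, c = 2 for peaks), and that the preimages of 2 1 3 ... (n+2)  *)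
(* contribute t sum_(i < n) M_i M_(n-1-i). The recurrence is solved by        *)
(*   M_n = sum_k binomial(n, 2k) C_k c^(n-2k) t^k,                            *)
(* which is the formula for V when c = 2 and, by the Vandermonde convolution, *)
(* gives the Narayana numbers when c = 1 + t.                                 *)
Require Import Defs.
From mathcomp Require Import all_boot all_order all_algebra finmap.
From mathcomp Require Import zify ring.

Set Implicit Arguments.
Unset Strict Implicit.
Unset Printing Implicit Defensive.

Import GRing.Theory Num.Theory.
Local Open Scope fset_scope.
Local Open Scope ring_scope.

(** * Fertility of a word under stack sorting *)

(** [mem_Av_last_max] leaves two target words, so only their fertilities under s have to be found.
    Since s(L N S) = s(L) s(S) N, the preimages of a word ending in its maximum N are classified by
    the position of N, each class being a product of preimages of a prefix and of the complementary
    suffix ([sort_preim_rcons], [fertility_rcons]). One computation serves all three counts: a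
    weight need only be multiplicative under this split, up to a factor that sees which of L, S is
    empty. It yields [fertility_sorted] and [fertility_swap]; the latter works because t times
    [self_conv] obeys the recursion of the swapped word ([self_conv_rec]). Weight 1 leads to Catalan
    numbers ([catn_quadratic_rec]); descents and peaks lead to polynomials whose coefficients come
    from [quad_poly]. *)

Lemma bigmax_mem (w : seq nat) : w != [::] -> \max_(x <- w) x \in w.
Proof.
elim: w => [|x [|y w] IHw] // _; first by rewrite big_seq1 mem_head.
rewrite big_cons /maxn; case: ifP => _; last exact: mem_head.
by rewrite inE IHw ?orbT.
Qed.

Lemma cat_index_split (w : seq nat) (N : nat) : N \in w ->
  take (index N w) w ++ N :: drop (index N w).+1 w = w.
Proof.
move=> Nw; rewrite -[RHS](cat_take_drop (index N w)).
by rewrite [in RHS](drop_nth 0%N) ?index_mem // nth_index.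
Qed.

Lemma stack_sort_rec_perm (k : nat) (w : seq nat) :
  (size w <= k)%N -> perm_eq (stack_sort_rec k w) w.
Proof.
elim: k w => [|k IHk] w; first by case: w.
move=> sz; have [->|w_neq0] := eqVneq w [::]; first by [].
have Nw := bigmax_mem w_neq0; move: sz.
have -> : stack_sort_rec k.+1 w =
    let N := \max_(x <- w) x in let i := index N w in
    stack_sort_rec k (take i w) ++ stack_sort_rec k (drop i.+1 w) ++ [:: N].
  by case: (w) w_neq0.
move: Nw; set N := \max_(x <- w) x => Nw /=; set i := index N w => sz.
have i_lt : (i < size w)%N by rewrite index_mem.
rewrite -[X in perm_eq _ X](cat_index_split Nw) -/i.
apply: perm_cat; first by apply: IHk; rewrite size_takel; lia.
by rewrite cats1 perm_rcons perm_cons; apply: IHk; rewrite size_drop; lia.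
Qed.

Lemma stack_sort_perm (w : seq nat) : perm_eq (stack_sort w) w.
Proof. exact: stack_sort_rec_perm. Qed.

(** Every preimage of [v] is a rearrangement of [v], so filtering its permutations loses none. *)
Definition sort_preim (v : seq nat) : seq (seq nat) :=
  [seq w <- permutations v | stack_sort w == v].

Lemma mem_sort_preim (v w : seq nat) : (w \in sort_preim v) = (stack_sort w == v).
Proof.
rewrite mem_filter mem_permutations; case: eqP => //= <-.
by rewrite perm_sym stack_sort_perm.
Qed.

Lemma sort_preim_uniq (v : seq nat) : uniq (sort_preim v).
Proof. exact/filter_uniq/permutations_uniq. Qed.

Lemma all_sort_preim (p : pred nat) (v w : seq nat) :
  w \in sort_preim v -> all p w = all p v.
Proof. by rewrite mem_sort_preim => /eqP <-; rewrite -(perm_all p (stack_sort_perm w)). Qed.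

Lemma size_sort_preim (v w : seq nat) : w \in sort_preim v -> size w = size v.
Proof. by rewrite mem_sort_preim => /eqP <-; rewrite (perm_size (stack_sort_perm w)). Qed.

Lemma index_cat_max (L R : seq nat) (N : nat) :
  all (ltn^~ N) L -> index N (L ++ N :: R) = size L.
Proof.
move=> /allP ltL; have NL : N \notin L by apply/negP => /ltL /=; rewrite ltnn.
by rewrite index_cat (negPf NL) /= eqxx addn0.
Qed.

(** Sorting preserves length, so once N stands at position [i] of w = L N S, the equation s(L) s(S)
    = v can only be cut after [i] letters. *)
Lemma sort_preim_rcons (v : seq nat) (N i : nat) :
    all (ltn^~ N) v -> (i <= size v)%N ->
  perm_eq [seq w <- sort_preim (rcons v N) | index N w == i]
          [seq L ++ N :: R | L <- sort_preim (take i v), R <- sort_preim (drop i v)].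
Proof.
move=> ltv le_i.
have ltLR : all (ltn^~ N) (take i v) && all (ltn^~ N) (drop i v).
  by rewrite -all_cat cat_take_drop.
have /andP[ltL ltR] := ltLR.
have szL L : L \in sort_preim (take i v) -> size L = i.
  by move/size_sort_preim ->; rewrite size_takel.
apply: uniq_perm.
- exact/filter_uniq/sort_preim_uniq.
- apply: allpairs_uniq; try exact: sort_preim_uniq.
  move=> _ _ /allpairsP[[L R] /= [/szL szL1 _ ->]] /allpairsP[[L' R'] /= [/szL szL2 _ ->]] /=.
  by move/eqP; rewrite eqseq_cat ?szL1 // => /andP[/eqP-> /eqP[->]].
move=> w; rewrite mem_filter mem_sort_preim; apply/andP/allpairsP => [[/eqP idx /eqP sw]|].
  have pw := stack_sort_perm w; rewrite sw in pw.
  have Nw : N \in w by rewrite -(perm_mem pw) mem_rcons mem_head.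
  have wE : w = take i w ++ N :: drop i.+1 w by rewrite -idx cat_index_split.
  have ltw : all (ltn^~ N) (take i w ++ drop i.+1 w).
    have : perm_eq (N :: (take i w ++ drop i.+1 w)) (N :: v).
      by rewrite perm_sym -perm_rcons (permPl pw) {1}wE -cat1s perm_catCA.
    by rewrite perm_cons => /(perm_all (ltn^~ N)) ->.
  have sz_i : size (take i w) = i by rewrite size_takel // -idx index_size.
  move: sw; rewrite {1}wE stack_sort_max // catA cats1 => /rcons_inj[vE].
  have sz_s : size (stack_sort (take i w)) = i by rewrite (perm_size (stack_sort_perm _)).
  by exists (take i w, drop i.+1 w); split=> //=; rewrite mem_sort_preim -vE
    ?take_size_cat ?drop_size_cat.
move=> [[L R] /= [Lin Rin ->]].
have ltLL : all (ltn^~ N) L by rewrite (all_sort_preim _ Lin).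
have ltRR : all (ltn^~ N) R by rewrite (all_sort_preim _ Rin).
rewrite index_cat_max // szL // eqxx; split=> //.
rewrite stack_sort_max ?all_cat ?ltLL // catA cats1.
move: Lin Rin; rewrite !mem_sort_preim => /eqP-> /eqP->.
by rewrite cat_take_drop.
Qed.

Section Weight.

Variables (R : comNzRingType) (weight : seq nat -> R) (eps : bool -> bool -> R).
Hypothesis weight_nil : weight [::] = 1.
Hypothesis weight_max : forall L S N, all (ltn^~ N) (L ++ S) ->
  weight (L ++ N :: S) = eps (nilp L) (nilp S) * (weight L * weight S).

(** The factor [eps] covers both statistics: the maximum N of L N S starts a descent exactly when S
    is nonempty, and is a peak exactly when both L and S are nonempty. *)
Definition fertility (v : seq nat) : R := \sum_(w <- sort_preim v) weight w.

Lemma fertility_nil : fertility [::] = 1.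
Proof. by rewrite /fertility /sort_preim /= big_seq1. Qed.

Lemma fertility_rcons (v : seq nat) (N : nat) : all (ltn^~ N) v ->
  fertility (rcons v N) =
  \sum_(i < (size v).+1)
     eps (i == 0 :> nat) (i == size v :> nat) * (fertility (take i v) * fertility (drop i v)).
Proof.
move=> ltv; rewrite /fertility.
(* N occurs in every preimage, so its index is at most [size v] and [inord] does not truncate it. *)
pose p w : 'I_(size v).+1 := inord (index N w).
rewrite (partition_big p xpredT) //=; apply: eq_bigr => i _.
rewrite -[LHS]big_filter.
have -> : [seq w <- sort_preim (rcons v N) | p w == i]
        = [seq w <- sort_preim (rcons v N) | index N w == i].
  apply: eq_in_filter => w w_in; rewrite -val_eqE /= inordK //.
  have := size_sort_preim w_in; rewrite size_rcons => <-.
  rewrite index_mem; move: w_in; rewrite mem_sort_preim => /eqP sw.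
  by rewrite -(perm_mem (stack_sort_perm w)) sw mem_rcons mem_head.
have le_i : (i <= size v)%N by rewrite -ltnS.
rewrite (perm_big _ (sort_preim_rcons ltv le_i)) big_allpairs_dep.
rewrite mulr_suml mulr_sumr big_seq [RHS]big_seq; apply: eq_bigr => L L_in.
rewrite !mulr_sumr big_seq [RHS]big_seq; apply: eq_bigr => S S_in.
rewrite weight_max.
  rewrite /nilp (size_sort_preim L_in) (size_sort_preim S_in).
  rewrite size_takel // size_drop.
  by have -> : (size v - i == 0)%N = (i == size v :> nat) by rewrite subn_eq0 eqn_leq le_i.
by rewrite all_cat (all_sort_preim _ L_in) (all_sort_preim _ S_in) -all_cat cat_take_drop.
Qed.

End Weight.

(** * The quadratic recurrence and the fertilities that satisfy it *)

Section QuadraticRecurrence.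

Variables (R : comNzRingType) (c t : R) (M : nat -> R).

Definition self_conv (n : nat) : R := \sum_(i < n) M i * M (n - i.+1).

(** The recurrence of weighted Motzkin paths: a level step weighs c, and a matched pair of an up and
    a down step weighs t. *)
Definition quadratic_rec : Prop :=
  M 0 = 1 /\ forall n, M n.+1 = c * M n + t * self_conv n.

(* Here [t * self_conv M i = M i.+1 - c * M i], so the sum on the right is    *)
(* a shift of [self_conv M] minus [c * self_conv M n].                        *)
Lemma self_conv_rec (n : nat) : quadratic_rec ->
  t * self_conv n.+1 =
  c * (t * self_conv n) + t * M n
  + t * \sum_(i < n) t * self_conv i * M (n - i.+1).
Proof.
move=> [M0 MS].
rewrite (eq_bigr (fun i : 'I_n =>
  M i.+1 * M (n - i.+1) - c * (M i * M (n - i.+1)))); last first.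
  by move=> i _; rewrite MS; ring.
rewrite sumrB -mulr_sumr -/(self_conv n) /self_conv big_ord_recl M0 subn1 /=.
under [in LHS]eq_bigr => i _ do rewrite subSS.
ring.
Qed.

End QuadraticRecurrence.

Lemma last_stack_sort (w : seq nat) : last 0%N (stack_sort w) = \max_(x <- w) x.
Proof. by case: w => [|x w]; rewrite ?big_nil // /stack_sort /= !last_cat. Qed.

Lemma bump0 (i : nat) : bump 0 i = i.+1.
Proof. by []. Qed.

Lemma sorted_rcons_max (v : seq nat) (N : nat) :
  sorted ltn (rcons v N) -> sorted ltn v /\ all (ltn^~ N) v.
Proof.
rewrite -(rev_sorted _ (rcons v N)) rev_rcons /= (path_sortedE (rev_trans ltn_trans)).
by rewrite all_rev rev_sorted => /andP[? ->].
Qed.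

Section WeightedFertility.

Variables (R : comNzRingType) (weight : seq nat -> R) (eps : bool -> bool -> R).
Variables (c t : R) (M : nat -> R).
Hypothesis weight_nil : weight [::] = 1.
Hypothesis weight_max : forall L S N, all (ltn^~ N) (L ++ S) ->
  weight (L ++ N :: S) = eps (nilp L) (nilp S) * (weight L * weight S).
Hypothesis eps_TT : eps true true = 1.
Hypothesis eps_c : eps true false + eps false true = c.
Hypothesis eps_FF : eps false false = t.
Hypothesis recM : quadratic_rec c t M.

(** Prefixes and suffixes of an increasing word are increasing, so only lengths matter. N in first
    or last position gives c M_n together, and the inner positions give the convolution. The index
    of M is one less than the length; the empty word has fertility 1 separately. *)
Lemma fertility_sorted (v : seq nat) (n : nat) :
  sorted ltn v -> size v = n.+1 -> fertility weight v = M n.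
Proof.
have [M0 MS] := recM.
have [k] := ubnP n; elim: k n v => // k IHk n v ltnk.
case/lastP: v => // u N /sorted_rcons_max[su ltu]; rewrite size_rcons => -[szu].
rewrite (fertility_rcons weight_max ltu) szu.
case: n => [|n] in ltnk szu *.
  by rewrite (size0nil szu) big_ord1 /= eps_TT (fertility_nil weight_nil) M0 !mul1r.
rewrite big_ord_recl big_ord_recr /= take0 drop0 eqxx.
rewrite take_oversize ?drop_oversize ?szu // (fertility_nil weight_nil) mul1r mulr1.
rewrite (IHk n u) // bump0 eqxx /= addrCA -mulrDl eps_c addrC MS mulr_sumr.
congr (_ + _); apply: eq_bigr => i _.
rewrite bump0 eqSS (ltn_eqF (ltn_ord i)) eps_FF (IHk i (take i.+1 u)) ?(IHk (n - i.+1)%N (drop i.+1 u)) //.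
all: rewrite ?take_sorted ?drop_sorted ?size_takel ?size_drop ?szu //.
all: have := ltn_ord i; lia.
Qed.

Lemma fertility_swap (a b : nat) (v : seq nat) :
    (a < b)%N -> path ltn b v ->
  fertility weight [:: b, a & v] = t * self_conv M (size v).
Proof.
move=> ltab; have [M0 _] := recM.
have [k] := ubnP (size v); elim: k v => // k IHk v.
case/lastP: v => [_ _|v N].
  (* A sorted image ends in its largest letter, so b a has no preimage; the convolution is empty
     too. *)
  rewrite /self_conv big_ord0 mulr0 /fertility big_seq big1 // => w.
  rewrite mem_sort_preim => /eqP sw; have := last_stack_sort w.
  have := @leq_bigmax_seq _ w xpredT id b.
  rewrite -(perm_mem (stack_sort_perm w)) sw mem_head => /(_ isT isT) /= + aE.
  by rewrite -aE leqNgt ltab.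
rewrite size_rcons ltnS => ltvk sbvN.
have sbav : sorted ltn [:: a, b & rcons v N] by rewrite /= ltab.
have [/= /andP[_ sbv] /and3P[aN bN vN]] := @sorted_rcons_max [:: a, b & v] N sbav.
have sav : path ltn a v by exact: (path_le ltn_trans ltab sbv).
rewrite (self_conv_rec _ recM).
rewrite -[b :: _]/(rcons [:: b, a & v] N) (fertility_rcons weight_max) /=; last by rewrite bN aN.
(* The extreme positions of N give the c term. Position 1 separates b from a and leaves two
   increasing words; every later position keeps b a in the prefix, where induction applies. *)
rewrite big_ord_recl big_ord_recr /= bump0 eqxx big_ord_recl /=.
rewrite take_oversize // drop_oversize // (fertility_nil weight_nil) mul1r mulr1.
rewrite !IHk // [LHS]addrC -[LHS]addrA -mulrDl [_ + eps true _]addrC eps_c.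
rewrite -[RHS]addrA [RHS]addrC; congr (_ + _ + _).
  by rewrite (fertility_sorted (n := 0)) // (fertility_sorted (n := size v)) // M0 mul1r eps_FF.
rewrite mulr_sumr; apply: eq_bigr => i _.
have lti := ltn_ord i; have szt : size (take i v) = i by rewrite size_takel // ltnW.
rewrite !bump0 /= add0n !eqSS (ltn_eqF lti) eps_FF IHk ?szt ?take_path //; last lia.
rewrite (fertility_sorted (n := (size v - i.+1)%N)) //; last by rewrite size_drop; lia.
by apply: drop_sorted; apply: path_sorted sav.
Qed.

End WeightedFertility.

(** * Descents, peaks and the avoidance class *)

Lemma size_descents_cons (x y : nat) (w : seq nat) :
  size (descents [:: x, y & w]) = ((y < x)%N + size (descents (y :: w)))%N.
Proof.
rewrite /descents !size_filter /index_iota /= !subn1 /=; congr (_ + _)%N.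
rewrite -[2%N]/(1 + 1)%N iotaDl count_map; apply: eq_in_count => -[|i] //.
by rewrite mem_iota.
Qed.

Lemma size_peaks_cons (x y z : nat) (w : seq nat) :
  size (peaks [:: x, y, z & w]) =
  (((x < y) && (z < y))%N + size (peaks [:: y, z & w]))%N.
Proof.
rewrite /peaks !size_filter /index_iota /= !subn2 /=; congr (_ + _)%N.
rewrite -[3%N]/(1 + 2)%N iotaDl count_map; apply: eq_in_count => -[|[|i]] //.
all: by rewrite mem_iota.
Qed.

Lemma size_descents_max (L S : seq nat) (N : nat) : all (ltn^~ N) (L ++ S) ->
  size (descents (L ++ N :: S)) =
  (~~ nilp S + (size (descents L) + size (descents S)))%N.
Proof.
elim: L => [|x [|y L] IHL] /=.
- by case: S => [|y S] //= /andP[yN _]; rewrite size_descents_cons yN.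
- move=> /andP[xN SN]; rewrite size_descents_cons IHL //.
  by rewrite ltnNge (ltnW xN).
- move=> /andP[xN yLSN]; by rewrite !size_descents_cons IHL // addnCA -!addnA.
Qed.

Lemma size_peaks_max (L S : seq nat) (N : nat) : all (ltn^~ N) (L ++ S) ->
  size (peaks (L ++ N :: S)) =
  (~~ (nilp L || nilp S) + (size (peaks L) + size (peaks S)))%N.
Proof.
have peaksN : all (ltn^~ N) S -> size (peaks (N :: S)) = size (peaks S).
  case: S => [|y [|z S]] //= /andP[yN _].
  by rewrite size_peaks_cons ltnNge (ltnW yN).
elim: L => [|x [|y [|z L]] IHL] /=.
- exact: peaksN.
- move=> /andP[xN SN]; case: S SN peaksN {IHL} => [|y S] //= /andP[yN SN] peaksN.
  by rewrite size_peaks_cons xN yN peaksN //= yN.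
- move=> /andP[xN yLSN]; rewrite size_peaks_cons IHL //.
  by case/andP: yLSN => yN _; rewrite [(N < y)%N]ltnNge (ltnW yN) andbF.
- move=> /andP[xN yLSN]; by rewrite !size_peaks_cons IHL // addnCA -!addnA.
Qed.

Lemma order_iso3 (a b c p q r : nat) :
  order_iso [:: a; b; c] [:: p; q; r] =
  [&& (a < b) == (p < q), (b < a) == (q < p), (a < c) == (p < r),
      (c < a) == (r < p), (b < c) == (q < r) & (c < b) == (r < q)]%N.
Proof.
apply/idP/idP => [/andP[_ /forallP iso]|/and5P[ab ba ac ca /andP[bc cb]]].
  have isoE i j (lti : (i < 3)%N) (ltj : (j < 3)%N) :=
    forallP (iso (Ordinal lti)) (Ordinal ltj).
  by apply/and5P; split; last apply/andP; try split;
    [exact: (isoE 0 1)%N | exact: (isoE 1 0)%N | exact: (isoE 0 2)%N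
    | exact: (isoE 2 0)%N | exact: (isoE 1 2)%N | exact: (isoE 2 1)%N].
apply/andP; split=> //; apply/forallP => -[[|[|[|i]]] lti] //.
all: apply/forallP => -[[|[|[|j]]] ltj] //=.
all: by rewrite !ltnn.
Qed.

(* The four patterns are exactly those of length 3 whose last letter is not   *)
(* the largest.                                                               *)
Lemma avoid_last_not_max (w : seq nat) : uniq w ->
  reflect (forall a b c, subseq [:: a; b; c] w -> (a < c)%N && (b < c)%N)
    (all (fun tau => ~~ contains tau w)
      [:: [:: 1; 3; 2]; [:: 2; 3; 1]; [:: 3; 1; 2]; [:: 3; 2; 1]]%N).
Proof.
move=> uw; apply: (iffP idP) => [/and5P[av1 av2 av3 av4 _] a b c sub|last_max].
  have /= := subseq_uniq sub uw; rewrite !inE => /and3P[].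
  have iso tau : ~~ contains tau w -> ~~ order_iso [:: a; b; c] tau.
    by apply: contra => iso; apply/containsP; exists [:: a; b; c].
  move: (iso _ av1) (iso _ av2) (iso _ av3) (iso _ av4); rewrite !order_iso3; lia.
apply/allP => tau tau_in; apply/containsP => -[u sub iso].
have szu : size u = 3%N.
  by case/andP: iso => /eqP -> _; move: tau_in; rewrite !inE => /or4P[] /eqP ->.
case: u => [|a [|b [|c [|d u]]]] // in sub iso szu *.
move: iso (last_max _ _ _ sub).
by move: tau_in; rewrite !inE => /or4P[] /eqP ->; rewrite order_iso3; lia.
Qed.

Lemma sorted_subseq2 (v : seq nat) :
  (forall b c, subseq [:: b; c] v -> (b < c)%N) -> sorted ltn v.
Proof.
elim: v => // b v IHv ltv; rewrite /= (path_sortedE ltn_trans); apply/andP; split.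
  by apply/allP => c cv; apply: ltv; rewrite /= eqxx sub1seq.
by apply: IHv => x y xyv; apply: ltv; apply: subseq_trans xyv (subseq_cons _ _).
Qed.

Lemma sorted_perm_iota (n : nat) (w : seq nat) :
  perm_eq w (iota 1 n) -> sorted ltn w -> w = iota 1 n.
Proof.
move=> pw sw; apply: (irr_sorted_eq ltn_trans ltnn sw (iota_ltn_sorted 1 n)).
exact: perm_mem.
Qed.

(** Triples starting with the first letter force the letters from the third on to increase, and each
    of them exceeds the first two letters; only the order of those two is free. *)
Lemma mem_Av_last_max (n : nat) (w : seq nat) : (2 <= n)%N ->
  (w \in Av n [:: [:: 1; 3; 2]; [:: 2; 3; 1]; [:: 3; 1; 2]; [:: 3; 2; 1]]%N) =
  (w == iota 1 n) || (w == [:: 2, 1 & iota 3 (n - 2)]%N).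
Proof.
case: n => [|[|n]] // _; rewrite !subSS subn0.
rewrite inE /= inE mem_Sn andbC; apply/andP/idP => [[av pw]|].
  have uw : uniq w by rewrite (perm_uniq pw) iota_uniq.
  have {av} /(avoid_last_not_max uw) last_max := av.
  case: w => [|x [|y v]] in pw uw last_max *; try by have := perm_size pw.
  have sv : sorted ltn v.
    apply: sorted_subseq2 => b c bcv.
    have : subseq [:: x; b; c] [:: x, y & v].
      by rewrite /= eqxx; apply: subseq_trans bcv (subseq_cons _ _).
    by move/last_max => /andP[].
  have xyv : all (fun c => (x < c) && (y < c))%N v.
    by apply/allP => c cv; apply: last_max; rewrite /= !eqxx sub1seq.
  have [xv yv] : all (ltn x) v /\ all (ltn y) v by apply/andP; rewrite -all_predI.
  have [ltxy|ltyx|eqxy] := ltngtP x y.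
  - by rewrite (sorted_perm_iota pw) ?eqxx //= ltxy (path_sortedE ltn_trans) yv.
  - have := @sorted_perm_iota n.+2 [:: y, x & v].
    rewrite -(perm_catCA [:: x] [:: y] v) /= ltyx (path_sortedE ltn_trans) xv.
    by move/(_ pw sv) => [-> -> ->]; rewrite eqxx orbT.
  - by move: uw; rewrite eqxy /= inE eqxx.
case/orP => /eqP ->.
  split=> //; apply/(avoid_last_not_max (iota_uniq 1 n.+2)).
  move=> a b c /(subseq_sorted ltn_trans)/(_ (iota_ltn_sorted _ _)) /=.
  by move=> /and3P[ab bc _]; rewrite bc (ltn_trans ab).
have pw : perm_eq [:: 2, 1 & iota 3 n]%N (iota 1 n.+2).
  by rewrite -(perm_catCA [:: 1%N] [:: 2%N] _).
have uw : uniq [:: 2, 1 & iota 3 n]%N by rewrite (perm_uniq pw) iota_uniq.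
split=> //; apply/(avoid_last_not_max uw).
have s2 : sorted ltn (2%N :: iota 3 n) := iota_ltn_sorted 2 n.+1.
have s1 : sorted ltn (1%N :: 2%N :: iota 3 n) := iota_ltn_sorted 1 n.+2.
(* The only inversion is the pair 2, 1. A triple using both ends in a letter at least 3; otherwise b
   and c come from 3, 4, ... in increasing order. *)
move=> a b c; rewrite /=; case: ifP => [/eqP->|_]; [case: ifP => [/eqP->|_]|case: ifP => [/eqP->|_]].
- by rewrite sub1seq mem_iota; lia.
- move=> bc; have : subseq [:: 2; b; c]%N (2%N :: iota 3 n) by [].
  by move/(subseq_sorted ltn_trans)/(_ s2) => /=; lia.
- move=> bc; have : subseq [:: 2; b; c]%N (2%N :: iota 3 n) by [].
  by move/(subseq_sorted ltn_trans)/(_ s2) => /=; lia.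
- move/(subseq_sorted ltn_trans)/(_ (path_sorted s2)) => /=; lia.
Qed.

(** * Catalan and Narayana numbers and the quadratic recurrence *)

(** The ballot form of the Catalan number, which stays in [nat]. *)
Definition catn (j : nat) : nat := 'C(2 * j, j) - 'C(2 * j, j.+1).

Lemma mul_catn (j : nat) : (j.+1 * catn j = 'C(2 * j, j))%N.
Proof.
rewrite mulnBr mul_bin_left -mulnBl.
by rewrite (_ : j.+1 - (2 * j - j) = 1)%N ?mul1n //; lia.
Qed.

Lemma catalanE (j : nat) : catalan j = (catn j)%:R.
Proof. by rewrite /catalan -mul_catn natrM mulKf // pnatr_eq0. Qed.

Lemma catnS (j : nat) : (j.+2 * catn j.+1 = (4 * j + 2) * catn j)%N.
Proof.
have bin1 := mul_bin_diag (2 * j).+2 j; have bin2 := mul_bin_diag (2 * j).+1 j.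
have : 'C((2 * j).+1, j.+1) = 'C((2 * j).+1, j).
  by rewrite -bin_sub; [congr 'C(_, _); lia|lia].
move: (mul_catn j) (mul_catn j.+1); rewrite (_ : 2 * j.+1 = (2 * j).+2)%N; last lia.
rewrite /= in bin1 bin2 *; nia.
Qed.

(** Write S_k for the convolution. Exchanging i and k - i gives 2 sum (i+1) C_i C_(k-i) = (k+2) S_k.
    At k = n+1 the ratio [catnS] turns the terms with i > 0 into multiples of those of S_n, and
    induction closes. *)
Lemma catn_conv (n : nat) :
  catn n.+1 = (\sum_(i < n.+1) catn i * catn (n - i))%N.
Proof.
pose S n := (\sum_(i < n.+1) catn i * catn (n - i))%N.
have sum_id k : (2 * (\sum_(i < k.+1) i * (catn i * catn (k - i))) = k * S k)%N.
  rewrite mul2n -addnn [X in (_ + X)%N](reindex_inj rev_ord_inj) -big_split /S big_distrr /=.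
  apply: eq_bigr => i _; have leik : (i <= k)%N by rewrite -ltnS.
  by rewrite subSS subKn // (mulnC (catn (k - i))) -mulnDl subnKC.
rewrite -/(S n); elim: n => [|n IHn]; first by rewrite /S big_ord1.
have sumS k : (2 * (\sum_(i < k.+1) i.+1 * (catn i * catn (k - i))) = k.+2 * S k)%N.
  under eq_bigr => i _ do rewrite mulSn.
  by rewrite big_split mulnDr sum_id -/(S k); lia.
have := sumS n.+1; rewrite big_ord_recl mul1n subn0 mulnDr.
under eq_bigr => i _ do rewrite lift0 subSS mulnA catnS -mulnA.
have -> : (\sum_(i < n.+1) (4 * i + 2) * (catn i * catn (n - i)) = (2 * n + 2) * S n)%N.
  transitivity (2 * (2 * (\sum_(i < n.+1) i * (catn i * catn (n - i)))) + 2 * S n)%N.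
    rewrite mulnA !big_distrr -big_split; apply: eq_bigr => i _ /=; ring.
  by rewrite sum_id; ring.
rewrite -IHn -[catn ord0]/1%N; have := catnS n.+1; nia.
Qed.

(** Both sides count the (p+q+1)-subsets of n points, on the left by the position i of their element
    number p+1. *)
Lemma sum_bin_bin (n p q : nat) :
  (\sum_(i < n) 'C(i, p) * 'C(n - i.+1, q) = 'C(n, p + q.+1))%N.
Proof.
elim: n q => [|n IHn] q; first by rewrite big_ord0 bin_small; lia.
rewrite big_ord_recr /= subnn; case: q => [|q].
  under eq_bigr => i _ do rewrite bin0 -(bin0 (n - i.+1)).
  by rewrite IHn addn1 binS muln1.
rewrite muln0 addn0 addnS binS -addnS -(IHn q.+1) -(IHn q) -big_split; apply: eq_bigr => i _ /=.
by rewrite -mulnDr subSS -(subnSK (ltn_ord i)) binS.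
Qed.

(** * Closed form of the quadratic recurrence *)

Section QuadraticSolution.

Variables (R : comNzRingType) (c : R).

(** Motzkin paths of length n with k up steps: choose the 2k places of non-level steps, then a Dyck
    path on them. *)
Definition quad_coef (n k : nat) : R := ('C(n, 2 * k) * catn k)%:R * c ^+ (n - 2 * k).

Definition quad_poly (n : nat) : {poly R} := \poly_(k < n.+1) quad_coef n k.

Lemma coef_quad_poly (n k : nat) : (quad_poly n)`_k = quad_coef n k.
Proof.
rewrite coef_poly; case: ltnP => // ltnk.
by rewrite /quad_coef bin_small ?mul0r //; lia.
Qed.

Lemma quad_coef_mul (n i j k : nat) : (i < n)%N -> (j <= k)%N ->
  quad_coef i j * quad_coef (n - i.+1) (k - j) =
  ('C(i, 2 * j) * 'C(n - i.+1, 2 * (k - j)) * (catn j * catn (k - j)))%:R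
  * c ^+ (n - (2 * k).+1).
Proof.
move=> ltin lejk; rewrite /quad_coef.
(* Truncated subtraction spoils the exponents only where a binomial vanishes. *)
have [lti|lei] := ltnP i (2 * j); first by rewrite bin_small // !mul0r.
have [ltj|lej] := ltnP (n - i.+1) (2 * (k - j)).
  by rewrite (bin_small ltj) !(mul0r, mulr0, muln0, mul0n).
rewrite mulrACA -natrM -exprD mulnACA; congr (_ * _ ^+ _); lia.
Qed.

(** For the coefficient of index k+1, [sum_bin_bin] sums over positions and [catn_conv] over Catalan
    products; Pascal's rule then adds the level-step term. *)
Lemma quad_poly_rec : quadratic_rec c%:P 'X quad_poly.
Proof.
split=> [|n]; apply/polyP => k; rewrite coef_quad_poly.
  rewrite coef1; case: k => [|k]; first by rewrite /quad_coef mulr1.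
  by rewrite /quad_coef bin_small ?mul0r.
rewrite coefD coefCM coefXM coef_quad_poly; case: k => [|k] /=.
  by rewrite /quad_coef muln0 !bin0 !subn0 exprS addr0 mulrCA.
rewrite coef_sum.
transitivity (c * quad_coef n k.+1 +
  (\sum_(i < n) \sum_(j < k.+1) 'C(i, 2 * j) * 'C(n - i.+1, 2 * (k - j))
     * (catn j * catn (k - j)))%:R * c ^+ (n - (2 * k).+1)); last first.
  congr (_ + _); rewrite natr_sum mulr_suml; apply: eq_bigr => i _.
  rewrite coefM natr_sum mulr_suml; apply: eq_bigr => j _.
  by rewrite !coef_quad_poly quad_coef_mul // -ltnS.
have -> : (\sum_(i < n) \sum_(j < k.+1) 'C(i, 2 * j) * 'C(n - i.+1, 2 * (k - j))
     * (catn j * catn (k - j)) = 'C(n, (2 * k).+1) * catn k.+1)%N.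
  rewrite exchange_big catn_conv big_distrr; apply: eq_bigr => j _ /=.
  by rewrite -big_distrl sum_bin_bin; congr ('C(_, _) * _)%N; have := ltn_ord j; lia.
rewrite /quad_coef (_ : 2 * k.+1 = (2 * k).+2)%N ?subSS; last lia.
rewrite binS mulnDl natrD mulrDl mulrCA -exprS; congr (_ + _).
have [ltn2k|le2k] := ltnP n (2 * k).+2; first by rewrite bin_small // !mul0r.
by congr (_ * _ ^+ _); lia.
Qed.

Lemma quad_poly_horner_rec (t : R) : quadratic_rec c t (fun n => (quad_poly n).[t]).
Proof.
have [p0 pS] := quad_poly_rec; split=> [|n]; first by rewrite p0 hornerC.
rewrite pS !hornerE horner_sum; congr (_ + _ * _).
by apply: eq_bigr => i _; rewrite hornerM.
Qed.

End QuadraticSolution.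

(** * Coefficients of the solution: Narayana numbers and V *)

Lemma natr_bin_fact (p q : nat) :
  ('C(p + q, p))%:R = ((p + q)`!)%:R / ((p`!)%:R * (q`!)%:R) :> rat.
Proof.
have := bin_fact (leq_addr q p); rewrite addKn => <-.
by rewrite !natrM mulfK // mulf_neq0 // pnatr_eq0 -lt0n fact_gt0.
Qed.

(* Both sides are (n+1)! / (k! (k+1)! (m-k)! (n-m-k)!).                       *)
Lemma bin_catn_bin (n m k : nat) : (k <= m)%N ->
  (n.+1 * ('C(n, 2 * k) * catn k * 'C(n - 2 * k, m - k)) =
   'C(n.+1, m.+1) * ('C(m.+1, m - k) * 'C(n - m, k)))%N.
Proof.
move=> lekm; have [ltn_mk|lemk] := ltnP n (m + k).
  transitivity 0%N; last first.
    have [?|?] := ltnP n m; first by rewrite bin_small.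
    by rewrite (@bin_small (n - m)) ?muln0 //; lia.
  have [?|?] := ltnP n (2 * k); first by rewrite bin_small // !muln0.
  by rewrite (@bin_small (n - 2 * k)) ?muln0 //; lia.
have [p mE] : exists p, m = (k + p)%N by exists (m - k)%N; lia.
have [r nE] : exists r, n = (2 * k + (p + r))%N by exists (n - m - k)%N; lia.
apply/eqP; rewrite -(eqr_nat rat) !natrM; apply/eqP.
have cat_fact : (catn k)%:R = (2 * k)`!%:R / (k.+1%:R * (k`!%:R * k`!%:R)) :> rat.
  have := natr_bin_fact k k; rewrite addnn -mul2n -catalanE /catalan => ->.
  by rewrite mulrCA -invfM.
rewrite cat_fact nE mE.
have -> : (2 * k + (p + r) - 2 * k = p + r)%N by lia.
have -> : (k + p - k = p)%N by lia.
have -> : (2 * k + (p + r) - (k + p) = k + r)%N by lia.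
have -> : (2 * k + (p + r)).+1 = ((k + p).+1 + (k + r))%N by lia.
have -> : (k + p).+1 = (p + k.+1)%N by lia.
rewrite !natr_bin_fact (_ : (p + k.+1 + (k + r) = (2 * k + (p + r)).+1)%N); last lia.
have fact_neq0 i : i`!%:R != 0 :> rat by rewrite pnatr_eq0 -lt0n fact_gt0.
rewrite !factS !natrM; field.
by rewrite !fact_neq0 nat1r pnatr_eq0.
Qed.

(** By [bin_catn_bin] the factor binomial(n+1, m+1) leaves the sum; the rest is a Vandermonde
    convolution with value binomial(n+1, m). *)
Lemma narayana_sum (n m : nat) :
  (\sum_(k < m.+1) 'C(n, 2 * k) * catn k * 'C(n - 2 * k, m - k))%:R = Nnum n.+1 m.+1.
Proof.
rewrite /Nnum -mulrA; apply: (canRL (mulKf _)); first by rewrite pnatr_eq0.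
rewrite -!natrM big_distrr /=; congr _%:R.
under eq_bigr => k _ do rewrite bin_catn_bin -1?ltnS //.
rewrite -big_distrr /=; have [ltnm|lemn] := ltnP n m; first by rewrite bin_small.
congr (_ * _)%N; rewrite (reindex_inj rev_ord_inj) /=.
rewrite (_ : n.+1 = m.+1 + (n - m))%N; last lia.
rewrite -binomial.Vandermonde; apply: eq_bigr => k _.
by rewrite subSS subKn // -ltnS.
Qed.

Lemma coef_exp1X (n k : nat) : (('X + 1) ^+ n : {poly rat})`_k = 'C(n, k)%:R.
Proof.
elim: n k => [|n IHn] k; first by rewrite expr0 coef1 bin0n eq_sym.
rewrite exprSr mulrDr mulr1 coefD coefMX IHn.
by case: k => [|k] /=; rewrite ?IHn ?bin0 ?add0r // binS natrD addrC.
Qed.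

Lemma coef_quad_poly_narayana (n m : nat) :
  (quad_poly ('X + 1 : {poly rat}) n).['X]`_m = Nnum n.+1 m.+1.
Proof.
(* A common range for the polynomial's sum (up to n) and the Narayana sum (up to m). *)
have sz : (size (quad_poly ('X + 1 : {poly rat}) n) <= n.+1 + m.+1)%N.
  by apply: leq_trans (size_poly _ _) (leq_addr _ _).
rewrite -narayana_sum (horner_coef_wide _ sz) coef_sum natr_sum.
pose a k : rat := ('C(n, 2 * k) * catn k * 'C(n - 2 * k, m - k))%:R.
rewrite (big_ord_widen (n.+1 + m.+1) a) ?leq_addl // [RHS]big_mkcond.
apply: eq_bigr => k _; rewrite coef_quad_poly coefMXn ltnS.
case: leqP => // _; rewrite /a natrM /quad_coef mulr_natl coefMn coef_exp1X.
by rewrite mulr_natl.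
Qed.

Lemma coef_quad_poly_peaks (n m : nat) :
  (quad_poly (2 : {poly rat}) n).['X]`_m = Vnum n.+1 m.+1.
Proof.
have sz : (size (quad_poly (2 : {poly rat}) n) <= n.+1 + m.+1)%N.
  by apply: leq_trans (size_poly _ _) (leq_addr _ _).
have ltm : (m < n.+1 + m.+1)%N by rewrite addnS ltnS leq_addl.
rewrite (horner_coef_wide _ sz) coef_sum (bigD1 (Ordinal ltm)) //= big1 => [|k neqk].
  rewrite addr0 coef_quad_poly coefMXn ltnn subnn /quad_coef -natrX -natrM -polyC_natr coefC /=.
  rewrite /Vnum catalanE (_ : 2 * m.+1 - 2 = 2 * m)%N /=; last lia.
  (* The integer exponent of 2 is n - 2m; when it is negative the binomial is 0. *)
  have [ltn2m|le2m] := ltnP n (2 * m); first by rewrite bin_small // mulr0 !mul0r.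
  rewrite (_ : _ + 1 = (n - 2 * m)%N :> int); last lia.
  by rewrite -exprnP -natrX !natrM mulrC mulrA.
rewrite coef_quad_poly /quad_coef coefMXn -natrX -natrM -polyC_natr coefC.
rewrite subn_eq0; case: ltnP => // lekm; case: leqP => // lemk; case/eqP: neqk.
by apply: val_inj => /=; apply/eqP; rewrite eqn_leq lekm.
Qed.

(** The two end terms of the Catalan convolution, both with a factor C_0 = 1, supply the coefficient
    2. *)
Lemma catn_quadratic_rec : quadratic_rec 2 1 (fun n => (catn n.+1)%:R : rat).
Proof.
split=> // n; rewrite catn_conv big_ord_recl big_ord_recr /= bump0 subnn subn0.
rewrite mul1n muln1 !natrD natr_sum mul1r.
rewrite [LHS]addrC -[LHS]addrA -mulr2n mulr_natl [RHS]addrC; congr (_ + _).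
by apply: eq_bigr => i _; rewrite !bump0 natrM subSS -(subnSK (ltn_ord i)).
Qed.

(** * Assembling the counts for the two target words *)

Section Preimage.

Variables (R : comNzRingType) (weight : seq nat -> R) (eps : bool -> bool -> R).
Variables (c t : R) (M : nat -> R).
Hypothesis weight_nil : weight [::] = 1.
Hypothesis weight_max : forall L S N, all (ltn^~ N) (L ++ S) ->
  weight (L ++ N :: S) = eps (nilp L) (nilp S) * (weight L * weight S).
Hypothesis eps_TT : eps true true = 1.
Hypothesis eps_c : eps true false + eps false true = c.
Hypothesis eps_FF : eps false false = t.
Hypothesis recM : quadratic_rec c t M.

Lemma weight_preim (n : nat) :
  \sum_(w <- sort_preim (iota 1 n.+2) ++ sort_preim [:: 2, 1 & iota 3 n]%N) weight w
  = M n.+1 + t * self_conv M n.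
Proof.
rewrite big_cat -!/(fertility weight _); congr (_ + _).
  rewrite (fertility_sorted weight_nil weight_max eps_TT eps_c eps_FF recM (n := n.+1)) //.
    exact: iota_ltn_sorted.
  by rewrite size_iota.
rewrite (fertility_swap weight_nil weight_max eps_TT eps_c eps_FF recM) ?size_iota //.
exact: (path_sorted (iota_ltn_sorted 1 n.+2)).
Qed.

End Preimage.

Lemma coef_sum_exp (T : Type) (s : seq T) (f : T -> nat) (m : nat) :
  (\sum_(w <- s) 'X^(f w) : {poly rat})`_m = (count (fun w => f w == m) s)%:R.
Proof.
rewrite coef_sum -sum1_count natr_sum [RHS]big_mkcond /=.
by apply: eq_bigr => w _; rewrite coefXn eq_sym; case: eqP.
Qed.

(** [M i] belongs to words of length i+1, and the factor ['X] lowers the degree read from the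
    convolution by one; hence the sums start at 1. *)
Lemma coef_preim_formula (M : nat -> {poly rat}) (F : nat -> nat -> rat) (n m : nat) :
    (forall i j, (M i)`_j = F i.+1 j.+1) ->
  (M n.+1 + 'X * self_conv M n)`_m =
  F n.+2 m.+1 + \sum_(1 <= i < n.+1) \sum_(1 <= j < m.+1)
     F (n.+2 - i - 1)%N j * F i (m - j + 1)%N.
Proof.
move=> MF; rewrite coefD MF coefXM; congr (_ + _).
case: m => [|m] /=; first by rewrite big1 // => i _; rewrite big_geq.
rewrite big_add1 /= big_mkord coef_sum; apply: eq_bigr => i _.
rewrite mulrC coefM big_add1 /= big_mkord; apply: eq_bigr => j _.
have lti := ltn_ord i; have ltj := ltn_ord j.
by rewrite !MF; congr (F _ _ * F _ _); lia.
Qed.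

Theorem theorem4p1 (n : nat) (hn : (2 <= n)%N) :
  let P : {fset seq nat} :=
    stack_preim n
      (Av n [:: [:: 1; 3; 2]; [:: 2; 3; 1]; [:: 3; 1; 2]; [:: 3; 2; 1]]%N) in
  [/\ (#|` P|)%:R = 2 * catalan n - 2 * catalan n.-1,
      forall m : nat,
        (#|` [fset w in P | size (descents w) == m]|)%:R
        = Nnum n m.+1
          + \sum_(1 <= i < n.-1) \sum_(1 <= j < m.+1)
              Nnum (n - i - 1)%N j * Nnum i (m - j + 1)%N
    & forall m : nat,
        (#|` [fset w in P | size (peaks w) == m]|)%:R
        = Vnum n m.+1
          + \sum_(1 <= i < n.-1) \sum_(1 <= j < m.+1)
              Vnum (n - i - 1)%N j * Vnum i (m - j + 1)%N].
Proof.
case: n hn => [|[|n]] // hn P.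
pose s := sort_preim (iota 1 n.+2) ++ sort_preim [:: 2, 1 & iota 3 n]%N.
have us : uniq s.
  rewrite cat_uniq !sort_preim_uniq andbT; apply/hasPn => w.
  by rewrite /= !mem_sort_preim => /eqP ->.
have memP w : (w \in P) = (w \in s).
  rewrite mem_cat !mem_sort_preim inE /= inE mem_Sn mem_Av_last_max //.
  rewrite !subSS subn0 andb_idl // -(permPl (stack_sort_perm w)).
  case/orP => /eqP -> //.
  by rewrite -(perm_catCA [:: 1%N] [:: 2%N] _).
have cardP (p : pred (seq nat)) : #|` [fset w in P | p w]| = count p s.
  rewrite -size_filter -(undup_id (filter_uniq p us)) -card_fseq.
  suff -> : [fset w in P | p w] = [fset w in [seq w <- s | p w]] by [].
  by apply/fsetP => w; rewrite [in RHS]inE /= mem_filter -memP andbC inE.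
split=> [|m|m].
- have -> : P = [fset w in P | predT w] by apply/fsetP => w; rewrite [in RHS]inE -[LHS]andbT.
  rewrite cardP count_predT -sum1_size natr_sum !catalanE.
  (* With weight 1 the total is C_(n+2) plus the convolution, which the recurrence evaluates as
     C_(n+2) - 2 C_(n+1). *)
  rewrite (weight_preim (eps := fun _ _ => 1) _ _ _ _ _ catn_quadratic_rec) ?mul1r //.
  have [_ /(_ n)] := catn_quadratic_rec; rewrite mul1r => cS.
  rewrite [n.+2.-1]/= -(addrK (2 * (catn n.+1)%:R) (self_conv _ n)) [self_conv _ _ + _]addrC -cS; ring.
- rewrite cardP -coef_sum_exp.
  rewrite (weight_preim (eps := fun _ r => 'X^(~~ r)) (c := 'X + 1) (t := 'X)
    _ _ _ _ _ (quad_poly_horner_rec _ 'X)) //.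
  + by apply: coef_preim_formula => i j; exact: coef_quad_poly_narayana.
  + by move=> L S N ltN; rewrite size_descents_max // !exprD.
- rewrite cardP -coef_sum_exp.
  rewrite (weight_preim (eps := fun l r => 'X^(~~ (l || r))) (c := 2) (t := 'X)
    _ _ _ _ _ (quad_poly_horner_rec _ 'X)) //.
  + by apply: coef_preim_formula => i j; exact: coef_quad_poly_peaks.
  + by move=> L S N ltN; rewrite size_peaks_max // !exprD.
Qed.
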